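(* The natural ternary operation on a right modular groupoid is not necessarily a semiheap; that is, there exists a right modular groupoid $S$ such that $S$ with the ternary operation $[abc]=(ab)c$ is not a semiheap.
   Context: A groupoid is a set with a binary operation, written as juxtaposition. A groupoid is right modular if $(xy)z=(zy)x$ for all $x,y,z$. A set with a ternary operation $[\ ]$ is a semiheap if $[[xyz]uv]=[x[uzy]v]=[xy[zuv]]$ for all $x,y,z,u,v$. *)

(* Defs.v *)
(* A groupoid is a type [S] with a binary operation [S -> S -> S]; no further
   law, and in particular no decidable equality or choice operator, is assumed. *)

Definition right_modular (S : Type) (op : S -> S -> S) : Prop :=
  forall x y z : S, op (op x y) z = op (op z y) x.

(* The middle expression reverses the order of [y], [z], [u]. *)
Definition semiheap (S : Type) (t : S -> S -> S -> S) : Prop :=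
  forall x y z u v : S,
    t (t x y z) u v = t x (t u z y) v /\
    t x (t u z y) v = t x y (t z u v).

Definition natural_ternary (S : Type) (op : S -> S -> S) : S -> S -> S -> S :=
  fun a b c => op (op a b) c.

(* Main.v *)
Require Import Defs.
From Stdlib Require Import Lia.

(* The law [a x + b y] over a commutative semiring is right modular as soon as
   [b = a * a]; the coefficient of [x] is then [b * b] in [[xyz]uv] but [b] in
   [x[uzy]v], so [a = 2] over [nat] fails at [x = 1], [y = z = u = v = 0]. *)
Theorem proposition2 :
  exists (S : Type) (op : S -> S -> S),
    right_modular S op /\ ~ semiheap S (natural_ternary S op).
Proof.
  exists nat, (fun x y => 2 * x + 4 * y).
  split.
  (* Both sides expand to [4 * x + 8 * y + 4 * z]: the outer coefficients [a * a] and [b] agree, so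
     swapping [x] and [z] changes nothing, and the goal is linear. *)
  - intros x y z. lia.
  (* The bracket of [a], [b], [c] is [4 * a + 8 * b + 4 * c]. On the left [1] passes through two
     brackets and on the right through one, so the first equation computes to [16 = 4]. *)
  - intros H. destruct (H 1 0 0 0 0) as [H1 _]. discriminate H1.
Qed.
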